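(* Let $\gamma_1,\gamma_2>0$ be real numbers such that either $2(\gamma_1-\gamma_2-e(e+1))\geq \pi e$ or $2(1-e(1+\gamma_1+\gamma_2))\geq \pi$. If $p$ is an analytic function in $\mathbb{D}$ such that $p(0)=1$ and $$p(z)+\gamma_1 zp'(z)+\gamma_2 z^2p''(z)\prec 1+\sinh^{-1} z,$$ then $p(z)\prec e^z$.
   Context: $\mathbb{D}=\{z\in\mathbb{C}:|z|<1\}$ is the open unit disk. Here $\sinh^{-1}$ is the principal branch of the inverse hyperbolic sine, $\sinh^{-1}z=\log(z+\sqrt{1+z^2})$, analytic on $\mathbb{D}$ with value $0$ at $z=0$. For analytic functions $g,h$ on $\mathbb{D}$, $g\prec h$ ($g$ is subordinate to $h$) means that there is an analytic function $w:\mathbb{D}\to\mathbb{D}$ with $w(0)=0$ and $|w(z)|\le|z|$ such that $g(z)=h(w(z))$ for all $z\in\mathbb{D}$. *)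

(* Defs.v *)
From Stdlib Require Import Reals.
From Coquelicot Require Import Coquelicot.

Open Scope C_scope.

Definition unit_disk (z : C) : Prop := (Cmod z < 1)%R.

(* Analytic at z0: equal to the sum of a convergent complex power series
   centred at z0 on some disk around z0. *)
Definition analytic_at (f : C -> C) (z0 : C) : Prop :=
  exists (r : posreal) (a : nat -> C),
    forall z : C, (Cmod (z - z0) < r)%R ->
      @is_pseries C_AbsRing C_NormedModule a (z - z0) (f z).

Definition analytic_on (U : C -> Prop) (f : C -> C) : Prop :=
  forall z : C, U z -> analytic_at f z.

(* Euler: e^(x + iy) = e^x (cos y + i sin y). *)
Definition Cexp (z : C) : C :=
  (exp (Re z) * cos (Im z), exp (Re z) * sin (Im z))%R.

(* Principal argument, with values in (-PI, PI], for z <> 0. *)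
Definition Carg (z : C) : R :=
  if Rle_dec 0 (Im z) then acos (Re z / Cmod z) else (- acos (Re z / Cmod z))%R.

(* Principal branches. Clog and Csqrt have no meaning at 0; Casinh only applies
   them to nonzero numbers when z is in the unit disk. *)
Definition Clog (z : C) : C := (ln (Cmod z), Carg z).

Definition Csqrt (z : C) : C := Cexp (Clog z / 2).

Definition Casinh (z : C) : C := Clog (z + Csqrt (1 + z ^ 2)).

Definition subordinate (g h : C -> C) : Prop :=
  exists w : C -> C,
    analytic_on unit_disk w /\
    (forall z : C, unit_disk z -> unit_disk (w z)) /\
    w 0 = 0 /\
    (forall z : C, unit_disk z -> (Cmod (w z) <= Cmod z)%R) /\
    (forall z : C, unit_disk z -> g z = h (w z)).

(* Main.v *)
Require Import Defs.
From Stdlib Require Import Reals Lra Lia.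
From Coquelicot Require Import Coquelicot.

Open Scope C_scope.

(** Along the ray [t |-> t z] the differential operator of the theorem becomes
    the real Euler operator [q + gamma1 t q' + gamma2 t^2 q''] acting on
    [q t = p (t z) - 1], and the hypothesis says that its value [h t] is
    [Casinh (w (t z))] with [|w (t z)| <= t |z|]. In the variable [log t] this is
    a damped oscillator with damping [d = gamma1 - gamma2], driven by [h]. Its
    energy [E = (gamma2 |t q'|^2 + |q|^2) / 2] vanishes at [t = 0] and satisfies
    [t E' = Re (conj (t q') h) - d |t q'|^2 <= |h|^2 / (4 d)], uniformly in
    [gamma2] ([euler_operator_energy_bound]).

    An elementary bound gives [|Casinh w| <= 3 |w|] ([Casinh_bound]), and the
    condition on the parameters gives [d >= 9] ([parameter_gap]); integrating the
    energy inequality from [0] to [1] yields [|p z - 1| <= |z| / 2]. Since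
    [|Clog (1 + u)| <= 2 |u|] for [|u| <= 1/2] ([Clog_1_plus_bound]), the function
    [Clog o p] is bounded by [|z|], and it is the function that exhibits [p] as
    subordinate to the exponential ([subordinate_Cexp]).

    It remains to know that [Clog o p] is analytic in the sense of local power
    series ([analytic_at_Clog]). The coefficients of [p' / p] at a point solve the
    triangular system given by the Cauchy product [(p' / p) p = p'], which forces
    them to grow at most geometrically. Integrating termwise gives a power series
    [l] with [l' p = p'], so [p exp (- l)] has zero derivative, [p = exp l], and
    [l] is the principal logarithm near the centre by continuity.

    The calculus of complex power series needed for this is developed from
    geometric bounds on the coefficients: such a series is differentiable
    termwise, with a quadratic remainder ([Cpower_series_diff]). *)

(** * Complex series *)

Notation Cis_series u l := (@is_series C_AbsRing C_NormedModule u l).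

Lemma Re_sum_n (u : nat -> C) (N : nat) :
  Re (@sum_n C_AbelianMonoid u N) = sum_n (fun n => Re (u n)) N.
Proof.
  induction N as [|N IH].
  - now rewrite !sum_O.
  - rewrite !sum_Sn, <- IH. reflexivity.
Qed.

Lemma Im_sum_n (u : nat -> C) (N : nat) :
  Im (@sum_n C_AbelianMonoid u N) = sum_n (fun n => Im (u n)) N.
Proof.
  induction N as [|N IH].
  - now rewrite !sum_O.
  - rewrite !sum_Sn, <- IH. reflexivity.
Qed.

Lemma Cis_series_components (u : nat -> C) (l : C) :
  Cis_series u l <->
  is_series (fun n => Re (u n)) (Re l) /\ is_series (fun n => Im (u n)) (Im l).
Proof.
  pose proof (filterlim_locally (U := C_UniformSpace) (F := eventually)
                (@sum_n C_AbelianMonoid u) l) as HC.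
  pose proof (filterlim_locally (U := R_UniformSpace) (F := eventually)
                (sum_n (fun n => Re (u n))) (Re l)) as HR.
  pose proof (filterlim_locally (U := R_UniformSpace) (F := eventually)
                (sum_n (fun n => Im (u n))) (Im l)) as HI.
  split.
  - intros H. pose proof (proj1 HC H) as H1. clear H.
    split; [apply (proj2 HR) | apply (proj2 HI)]; intros eps;
      generalize (H1 eps); apply filter_imp; intros N [Br Bi].
    + now rewrite <- Re_sum_n.
    + now rewrite <- Im_sum_n.
  - intros [Hr Hi]. apply (proj2 HC). intros eps.
    generalize (filter_and _ _ (proj1 HR Hr eps) (proj1 HI Hi eps)).
    apply filter_imp. intros N [Br Bi]. split.
    + now rewrite <- Re_sum_n in Br.
    + now rewrite <- Im_sum_n in Bi.
Qed.

Lemma Cis_series_unique (u : nat -> C) (l l' : C) :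
  Cis_series u l -> Cis_series u l' -> l = l'.
Proof. apply (filterlim_locally_unique (V := C_NormedModule)). Qed.

Lemma Cis_series_ext (u v : nat -> C) (l : C) :
  (forall n, u n = v n) -> Cis_series u l -> Cis_series v l.
Proof. apply (is_series_ext (V := C_NormedModule)). Qed.

Lemma Cis_series_scal (c : C) (u : nat -> C) (l : C) :
  Cis_series u l -> Cis_series (fun n => c * u n) (c * l).
Proof. apply (is_series_scal (V := C_NormedModule)). Qed.

Lemma Cis_series_minus (u v : nat -> C) (l m : C) :
  Cis_series u l -> Cis_series v m -> Cis_series (fun n => u n - v n) (l - m).
Proof. apply (is_series_minus (V := C_NormedModule)). Qed.

Lemma Cis_series_bounded_terms (u : nat -> C) (l : C) :
  Cis_series u l -> exists B : R, forall n, (Cmod (u n) <= B)%R.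
Proof.
  intros H.
  destruct (filterlim_bounded (V := C_NormedModule) (sum_n u)) as [B HB].
  { now exists l. }
  exists (2 * B)%R. intros [|n].
  - specialize (HB 0%nat). rewrite sum_O in HB.
    change (Cmod (u 0%nat) <= B)%R in HB. pose proof (Cmod_ge_0 (u 0%nat)). lra.
  - pose proof (HB n) as H1. pose proof (HB (S n)) as H2. rewrite sum_Sn in H2.
    revert H1 H2. generalize (sum_n u n). intros s.
    change (Cmod s <= B -> Cmod (s + u (S n)) <= B -> Cmod (u (S n)) <= 2 * B)%R.
    intros H1 H2. replace (u (S n)) with ((s + u (S n)) + - s) by ring.
    pose proof (Cmod_triangle (s + u (S n)) (- s)). rewrite Cmod_opp in *. lra.
Qed.

Lemma Cis_series_geometric_bound (u : nat -> C) (l : C) (M q : R) :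
  (0 <= q < 1)%R -> (forall n, Cmod (u n) <= M * q ^ n)%R ->
  Cis_series u l -> (Cmod l <= M / (1 - q))%R.
Proof.
  intros Hq Hu Hl.
  assert (HN : forall N, (Cmod (@sum_n C_AbelianMonoid u N)
                          <= M * (1 - q ^ S N) / (1 - q))%R).
  { induction N as [|N IH].
    - rewrite sum_O. generalize (Hu 0%nat). simpl. intros H.
      replace (M * (1 - q * 1) / (1 - q))%R with (M * 1)%R by (field; lra). lra.
    - rewrite sum_Sn. apply Rle_trans with (1 := Cmod_triangle _ _).
      replace (M * (1 - q ^ S (S N)) / (1 - q))%R
        with (M * (1 - q ^ S N) / (1 - q) + M * q ^ S N)%R
        by (simpl; field; lra).
      apply Rplus_le_compat; auto. }
  assert (HM : (0 <= M)%R).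
  { generalize (Hu 0%nat) (Cmod_ge_0 (u 0%nat)). simpl. lra. }
  assert (Hlim : is_lim_seq (fun N => Cmod (@sum_n C_AbelianMonoid u N)) (Cmod l)).
  { exact (filterlim_comp _ _ _ _ (@norm C_AbsRing C_NormedModule) _ _ _ Hl
             (@filterlim_norm C_AbsRing C_NormedModule l)). }
  apply (is_lim_seq_le (fun N => Cmod (@sum_n C_AbelianMonoid u N))
           (fun _ => M / (1 - q))%R (Cmod l) (M / (1 - q))%R); auto.
  - intros N. apply Rle_trans with (1 := HN N).
    apply Rmult_le_compat_r; [left; apply Rinv_0_lt_compat; lra|].
    pose proof (pow_le q (S N) (proj1 Hq)). nra.
  - apply is_lim_seq_const.
Qed.

Lemma Rex_series_geometric (u : nat -> R) (M q : R) :
  (0 <= q < 1)%R -> (forall n, Rabs (u n) <= M * q ^ n)%R ->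
  ex_series (fun n => Rabs (u n)).
Proof.
  intros Hq Hu.
  apply (ex_series_le (K := R_AbsRing) (V := R_CompleteNormedModule)
           (fun n => Rabs (u n)) (fun n => M * q ^ n)%R).
  - intros n. change (Rabs (Rabs (u n)) <= M * q ^ n)%R. now rewrite Rabs_Rabsolu.
  - apply (ex_series_scal (K := R_AbsRing) (V := R_NormedModule) M).
    apply ex_series_geom. rewrite Rabs_pos_eq; lra.
Qed.

Lemma im_le_Cmod (z : C) : (Rabs (Im z) <= Cmod z)%R.
Proof.
  apply Rle_trans with (2 := Rmax_Cmod z). apply Rmax_r.
Qed.

(** Components reduce the Cauchy product to the real one. *)
Lemma Cis_series_mult (u v : nat -> C) (l m : C) (M N q : R) :
  (0 <= q < 1)%R ->
  (forall n, Cmod (u n) <= M * q ^ n)%R -> (forall n, Cmod (v n) <= N * q ^ n)%R ->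
  Cis_series u l -> Cis_series v m ->
  Cis_series (fun n => @sum_n C_AbelianMonoid (fun k => u k * v (n - k)%nat) n)
    (l * m).
Proof.
  intros Hq Hu Hv Hl Hm.
  apply Cis_series_components in Hl as [Hlr Hli].
  apply Cis_series_components in Hm as [Hmr Hmi].
  assert (Aur : ex_series (fun n => Rabs (Re (u n)))).
  { apply (Rex_series_geometric _ M q Hq). intros n.
    apply Rle_trans with (1 := re_le_Cmod _). auto. }
  assert (Aui : ex_series (fun n => Rabs (Im (u n)))).
  { apply (Rex_series_geometric _ M q Hq). intros n.
    apply Rle_trans with (1 := im_le_Cmod _). auto. }
  assert (Avr : ex_series (fun n => Rabs (Re (v n)))).
  { apply (Rex_series_geometric _ N q Hq). intros n.
    apply Rle_trans with (1 := re_le_Cmod _). auto. }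
  assert (Avi : ex_series (fun n => Rabs (Im (v n)))).
  { apply (Rex_series_geometric _ N q Hq). intros n.
    apply Rle_trans with (1 := im_le_Cmod _). auto. }
  pose proof (is_series_mult _ _ _ _ Hlr Hmr Aur Avr) as Prr.
  pose proof (is_series_mult _ _ _ _ Hli Hmi Aui Avi) as Pii.
  pose proof (is_series_mult _ _ _ _ Hlr Hmi Aur Avi) as Pri.
  pose proof (is_series_mult _ _ _ _ Hli Hmr Aui Avr) as Pir.
  apply Cis_series_components. split.
  - rewrite re_mult. generalize (is_series_minus _ _ _ _ Prr Pii).
    apply is_series_ext. intros n. rewrite Re_sum_n, <- !sum_n_Reals.
    change (sum_n (fun k => Re (u k) * Re (v (n - k)%nat)) n
            - sum_n (fun k => Im (u k) * Im (v (n - k)%nat)) n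
            = sum_n (fun k => Re (u k * v (n - k)%nat)) n)%R.
    rewrite !sum_n_Reals, <- minus_sum. apply sum_eq. intros k _.
    now rewrite re_mult.
  - rewrite im_mult. generalize (is_series_plus _ _ _ _ Pri Pir).
    apply is_series_ext. intros n. rewrite Im_sum_n, <- !sum_n_Reals.
    change (sum_n (fun k => Re (u k) * Im (v (n - k)%nat)) n
            + sum_n (fun k => Im (u k) * Re (v (n - k)%nat)) n
            = sum_n (fun k => Im (u k * v (n - k)%nat)) n)%R.
    rewrite !sum_n_Reals, <- plus_sum. apply sum_eq. intros k _.
    now rewrite im_mult.
Qed.

(** * Power series with geometrically bounded coefficients *)

(** Every power series with positive radius of convergence satisfies such a bound,
    and the bound is stable under differentiation, integration and division; no
    radius of convergence has to be tracked. *)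
Definition geometric (a : nat -> C) (M r : R) : Prop :=
  forall n, (Cmod (a n) <= M * r ^ n)%R.

Definition Cpower_series (a : nat -> C) (h : C) : C :=
  (Series (fun n => Re (a n * h ^ n)), Series (fun n => Im (a n * h ^ n))).

Lemma geometric_terms (a : nat -> C) (M r : R) (h : C) :
  geometric a M r -> forall n, (Cmod (a n * h ^ n) <= M * (r * Cmod h) ^ n)%R.
Proof.
  intros Ha n. rewrite Cmod_mult, Cmod_pow, Rpow_mult_distr, <- Rmult_assoc.
  apply Rmult_le_compat_r; auto. apply pow_le, Cmod_ge_0.
Qed.

Lemma Cpower_series_correct (a : nat -> C) (M r : R) (h : C) :
  geometric a M r -> (0 <= r)%R -> (r * Cmod h < 1)%R ->
  Cis_series (fun n => a n * h ^ n) (Cpower_series a h).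
Proof.
  intros Ha Hr Hh. pose proof (Cmod_ge_0 h).
  assert (Hq : (0 <= r * Cmod h < 1)%R) by nra.
  apply Cis_series_components. split; apply Series_correct, ex_series_Rabs;
    apply (Rex_series_geometric _ M _ Hq); intros n;
    apply Rle_trans with (2 := geometric_terms a M r h Ha n).
  - apply re_le_Cmod.
  - apply im_le_Cmod.
Qed.

(** The terms of a series converging at a point [s > 0] are bounded, which bounds
    the coefficients by a multiple of [(/ s) ^ n]. *)
Lemma analytic_at_geometric (f : C -> C) (z0 : C) :
  analytic_at f z0 <->
  exists (a : nat -> C) (M r : R), geometric a M r /\ (0 < r)%R /\
    forall h : C, (r * Cmod h < 1)%R -> f (z0 + h) = Cpower_series a h.
Proof.
  split.
  - intros [rho [a Ha]]. pose proof (cond_pos rho) as Hrho.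
    set (s := (rho / 2)%R).
    assert (Hs : (0 < s)%R) by (unfold s; lra).
    assert (HsC : Cmod (RtoC s) = s) by (rewrite Cmod_R; apply Rabs_pos_eq; lra).
    destruct (Cis_series_bounded_terms _ _ (Ha (z0 + s) ltac:(
      replace (z0 + s - z0) with (RtoC s) by ring; rewrite HsC; unfold s; lra)))
      as [B HB].
    assert (Hg : geometric a B (/ s)).
    { intros n. specialize (HB n). revert HB.
      change ((Cmod ((z0 + s - z0) ^ n * a n)%C <= B)%R ->
              (Cmod (a n) <= B * (/ s) ^ n)%R).
      replace (z0 + s - z0) with (RtoC s) by ring.
      rewrite Cmod_mult, Cmod_pow, HsC, pow_inv. intros HB.
      pose proof (pow_lt s n Hs).
      apply Rmult_le_reg_l with (s ^ n)%R; auto.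
      apply Rle_trans with (1 := HB). right. field. lra. }
    exists a, B, (/ s)%R. split; [exact Hg|].
    assert (Hs' : (0 < / s)%R) by now apply Rinv_0_lt_compat.
    split; [exact Hs'|]. intros h Hh.
    assert (Hh' : (Cmod h < s)%R).
    { apply Rmult_lt_reg_l with (/ s)%R; auto. rewrite Rinv_l; lra. }
    apply (Cis_series_unique (fun n => a n * h ^ n)).
    + generalize (Ha (z0 + h) ltac:(
        replace (z0 + h - z0) with h by ring; unfold s in *; lra)).
      apply Cis_series_ext. intros n.
      change ((z0 + h - z0) ^ n * a n = a n * h ^ n).
      replace (z0 + h - z0) with h by ring. ring.
    + apply (Cpower_series_correct a B (/ s)); auto. lra.
  - intros [a [M [r [Ha [Hr Hf]]]]].
    exists (mkposreal (/ r) (Rinv_0_lt_compat _ Hr)), a. simpl. intros z Hz.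
    assert (Hz' : (r * Cmod (z - z0) < 1)%R).
    { apply Rmult_lt_compat_l with (r := r) in Hz; auto.
      rewrite Rinv_r in Hz; lra. }
    replace (f z) with (f (z0 + (z - z0))) by (f_equal; ring).
    pose proof (Hf _ Hz') as Hfz. rewrite Hfz.
    generalize (Cpower_series_correct a M r (z - z0) Ha (Rlt_le _ _ Hr) Hz').
    apply Cis_series_ext. intros n.
    change (a n * (z - z0) ^ n = (z - z0) ^ n * a n).
    apply Cmult_comm.
Qed.

(** * Complex differentiability with a quadratic remainder *)

(** Analytic functions satisfy this stronger form of differentiability; the
    explicit quadratic remainder passes to restrictions to real segments without
    any limit argument. *)
Definition Cdiff_at (f : C -> C) (z l : C) : Prop :=
  exists K d : R, (0 < d)%R /\
    forall h : C, (Cmod h < d)%R ->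
      (Cmod (f (z + h) - f z - h * l)%C <= K * Cmod h ^ 2)%R.

Lemma Cdiff_at_C_derive (f : C -> C) (z l : C) :
  Cdiff_at f z l -> C_derive f z = l.
Proof.
  intros [K [d [Hd H]]]. apply is_C_derive_unique. split.
  { apply (is_linear_scal_l (K := C_AbsRing) (V := C_NormedModule)). }
  intros x Hx.
  apply (is_filter_lim_locally_unique (V := AbsRing_NormedModule C_AbsRing)) in Hx.
  subst x. intros eps.
  assert (HK : (0 < Rabs K + 1)%R) by (pose proof (Rabs_pos K); lra).
  assert (Hpos : (0 < Rmin d (eps / (Rabs K + 1)))%R).
  { apply Rmin_pos; auto. apply Rdiv_lt_0_compat; auto. apply cond_pos. }
  exists (mkposreal _ Hpos). intros y Hy.
  change (Cmod (y - z) < Rmin d (eps / (Rabs K + 1)))%R in Hy.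
  change (Cmod (f y - f z - (y - z) * l) <= eps * Cmod (y - z))%R.
  pose proof (Rlt_le_trans _ _ _ Hy (Rmin_l _ _)) as Hy1.
  pose proof (Rlt_le_trans _ _ _ Hy (Rmin_r _ _)) as Hy2.
  replace (f y) with (f (z + (y - z))) by (f_equal; ring).
  apply Rle_trans with (1 := H _ Hy1).
  pose proof (Cmod_ge_0 (y - z)). pose proof (Rle_abs K).
  assert ((Rabs K + 1) * Cmod (y - z) < eps)%R.
  { apply Rmult_lt_compat_l with (r := (Rabs K + 1)%R) in Hy2; auto.
    replace ((Rabs K + 1) * (eps / (Rabs K + 1)))%R with (pos eps) in Hy2
      by (field; lra). exact Hy2. }
  nra.
Qed.

(** By induction from [D (n + 1) = (z + h) D n + n z^(n - 1) h^2], where [D n] is the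
    remainder of order [n]. The factor [rho ^ 2] on the left avoids the truncated
    exponent [n - 2] on the right. *)
Lemma Cpow_remainder (z h : C) (rho : R) (n : nat) :
  (0 < rho)%R -> (Cmod z + Cmod h <= rho)%R ->
  (rho ^ 2 * Cmod ((z + h) ^ n - z ^ n - h * (INR n * z ^ pred n))
   <= INR n ^ 2 * rho ^ n * Cmod h ^ 2)%R.
Proof.
  intros Hrho Hzh. pose proof (Cmod_ge_0 z). pose proof (Cmod_ge_0 h).
  induction n as [|n IH].
  - replace ((z + h) ^ 0 - z ^ 0 - h * (INR 0 * z ^ pred 0)) with (RtoC 0)
      by (simpl; ring).
    rewrite Cmod_0. simpl. lra.
  - set (D := (z + h) ^ n - z ^ n - h * (INR n * z ^ pred n)) in *.
    assert (HD : (z + h) ^ S n - z ^ S n - h * (INR (S n) * z ^ pred (S n))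
                 = (z + h) * D + INR n * z ^ pred n * (h * h)).
    { unfold D. rewrite S_INR, RtoC_plus. destruct n as [|n]; simpl pred.
      - simpl. ring.
      - rewrite !Cpow_S. ring. }
    rewrite HD.
    assert (Hrem : (rho ^ 2 * Cmod (INR n * z ^ pred n * (h * h))
                    <= INR n * rho ^ S n * Cmod h ^ 2)%R).
    { rewrite !Cmod_mult, Cmod_pow, Cmod_R, Rabs_pos_eq by apply pos_INR.
      destruct n as [|n]; [simpl; lra|]. simpl pred.
      assert (Cmod z ^ n <= rho ^ n)%R by (apply pow_incr; lra).
      pose proof (pos_INR (S n)).
      replace (rho ^ 2 * (INR (S n) * Cmod z ^ n * (Cmod h * Cmod h)))%R
        with (INR (S n) * (rho * rho * (Cmod h * Cmod h)) * Cmod z ^ n)%R by ring.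
      replace (INR (S n) * rho ^ S (S n) * Cmod h ^ 2)%R
        with (INR (S n) * (rho * rho * (Cmod h * Cmod h)) * rho ^ n)%R
        by (simpl; ring).
      apply Rmult_le_compat_l; auto. apply Rmult_le_pos; auto.
      apply Rmult_le_pos; nra. }
    assert (Hmul : (Cmod ((z + h) * D) <= rho * Cmod D)%R).
    { rewrite Cmod_mult. apply Rmult_le_compat_r; [apply Cmod_ge_0|].
      apply Rle_trans with (1 := Cmod_triangle _ _); auto. }
    pose proof (Cmod_triangle ((z + h) * D) (INR n * z ^ pred n * (h * h))) as Ht.
    apply Rle_trans with
      (rho * (INR n ^ 2 * rho ^ n * Cmod h ^ 2)
       + INR n * rho ^ S n * Cmod h ^ 2)%R.
    + assert (0 <= rho ^ 2)%R by nra.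
      apply Rle_trans with (rho ^ 2 * (rho * Cmod D +
        Cmod (INR n * z ^ pred n * (h * h))))%R.
      { apply Rmult_le_compat_l; auto. lra. }
      rewrite Rmult_plus_distr_l. apply Rplus_le_compat; auto.
      replace (rho ^ 2 * (rho * Cmod D))%R with (rho * (rho ^ 2 * Cmod D))%R by ring.
      apply Rmult_le_compat_l; lra.
    + rewrite S_INR. pose proof (pos_INR n).
      assert (0 <= rho ^ S n * Cmod h ^ 2)%R.
      { apply Rmult_le_pos; [apply pow_le; lra | nra]. }
      replace (rho * (INR n ^ 2 * rho ^ n * Cmod h ^ 2)
               + INR n * rho ^ S n * Cmod h ^ 2)%R
        with ((INR n ^ 2 + INR n) * (rho ^ S n * Cmod h ^ 2))%R by (simpl; ring).
      rewrite Rmult_assoc. apply Rmult_le_compat_r; nra.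
Qed.

Definition deriv_coeffs (a : nat -> C) (n : nat) : C := INR (S n) * a (S n).

Lemma INR_S_le_pow2 (n : nat) : (INR (S n) <= 2 ^ n)%R.
Proof.
  induction n as [|n IH]; [simpl; lra|].
  assert (1 <= 2 ^ n)%R by (apply pow_R1_Rle; lra).
  rewrite S_INR. simpl pow. lra.
Qed.

Lemma geometric_deriv_coeffs (a : nat -> C) (M r : R) :
  geometric a M r -> geometric (deriv_coeffs a) (M * r) (2 * r).
Proof.
  intros Ha n. unfold deriv_coeffs.
  rewrite Cmod_mult, Cmod_R, Rabs_pos_eq by apply pos_INR.
  replace (M * r * (2 * r) ^ n)%R with (2 ^ n * (M * r ^ S n))%R
    by (rewrite Rpow_mult_distr; simpl; ring).
  apply Rmult_le_compat; auto using pos_INR, Cmod_ge_0, INR_S_le_pow2.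
Qed.

(** When [|z| + |h| <= / (8 r)], the sum of the remainders of the monomials is
    dominated by a geometric series of ratio 1/2, because
    [n ^ 2 / 8 ^ n <= (1/2) ^ n]. *)
Lemma Cpower_series_diff (a : nat -> C) (M r : R) (z : C) :
  geometric a M r -> (0 < r)%R -> (8 * r * Cmod z < 1)%R ->
  Cdiff_at (Cpower_series a) z (Cpower_series (deriv_coeffs a) z).
Proof.
  intros Ha Hr Hz.
  set (rho := (/ (8 * r))%R).
  assert (Hrho : (0 < rho)%R) by (apply Rinv_0_lt_compat; lra).
  assert (Hrr : (r * rho = / 8)%R) by (unfold rho; field; lra).
  assert (Hz' : (Cmod z < rho)%R).
  { apply Rmult_lt_reg_l with (8 * r)%R; [lra|]. unfold rho.
    rewrite Rinv_r; lra. }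
  exists (2 * M / rho ^ 2)%R, (rho - Cmod z)%R. split; [lra|]. intros h Hh.
  pose proof (Cmod_ge_0 z). pose proof (Cmod_ge_0 h).
  pose proof (Cmod_triangle z h).
  assert (Hsz : Cis_series (fun n => a n * z ^ n) (Cpower_series a z)).
  { apply Cpower_series_correct with M r; auto; nra. }
  assert (Hszh : Cis_series (fun n => a n * (z + h) ^ n) (Cpower_series a (z + h))).
  { apply Cpower_series_correct with M r; auto; nra. }
  assert (Hsd : Cis_series (fun n => a n * (INR n * z ^ pred n))
                  (Cpower_series (deriv_coeffs a) z)).
  { apply (is_series_decr_1 (V := C_NormedModule)).
    change (Cis_series (fun n => a (S n) * (INR (S n) * z ^ n))
      (Cpower_series (deriv_coeffs a) z + - (a 0%nat * (0 * z ^ 0)))).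
    replace (Cpower_series (deriv_coeffs a) z + - (a 0%nat * (0 * z ^ 0)))
      with (Cpower_series (deriv_coeffs a) z) by ring.
    generalize (Cpower_series_correct _ _ _ z (geometric_deriv_coeffs a M r Ha)
      ltac:(lra) ltac:(nra)).
    apply Cis_series_ext. intros n. unfold deriv_coeffs. ring. }
  assert (HM : (0 <= M)%R).
  { generalize (Ha 0%nat) (Cmod_ge_0 (a 0%nat)). simpl. lra. }
  replace (2 * M / rho ^ 2 * Cmod h ^ 2)%R
    with (M / rho ^ 2 * Cmod h ^ 2 / (1 - / 2))%R by (field; lra).
  apply Cis_series_geometric_bound with
    (u := fun n => a n * (z + h) ^ n - a n * z ^ n - h * (a n * (INR n * z ^ pred n))).
  - lra.
  - intros n.
    replace (a n * (z + h) ^ n - a n * z ^ n - h * (a n * (INR n * z ^ pred n)))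
      with (a n * ((z + h) ^ n - z ^ n - h * (INR n * z ^ pred n))) by ring.
    rewrite Cmod_mult.
    pose proof (Cpow_remainder z h rho n Hrho ltac:(lra)) as Hrem.
    set (D := Cmod ((z + h) ^ n - z ^ n - h * (INR n * z ^ pred n))) in *.
    assert (Hr2 : (0 < rho ^ 2)%R) by nra.
    apply Rmult_le_reg_l with (rho ^ 2)%R; auto.
    replace (rho ^ 2 * (M / rho ^ 2 * Cmod h ^ 2 * (/ 2) ^ n))%R
      with (M * r ^ n * (4 ^ n * rho ^ n * Cmod h ^ 2))%R.
    2:{ replace (/ 2)%R with (4 * (r * rho))%R by (rewrite Hrr; field).
        rewrite !Rpow_mult_distr. field. lra. }
    replace (rho ^ 2 * (Cmod (a n) * D))%R with (Cmod (a n) * (rho ^ 2 * D))%R by ring.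
    apply Rmult_le_compat; auto using Cmod_ge_0.
    { apply Rmult_le_pos; [lra | apply Cmod_ge_0]. }
    apply Rle_trans with (1 := Hrem). rewrite !Rmult_assoc.
    apply Rmult_le_compat_r.
    { apply Rmult_le_pos; [apply pow_le; lra | nra]. }
    replace 4%R with (2 * 2)%R by ring. rewrite Rpow_mult_distr.
    pose proof (INR_S_le_pow2 n) as Hn. rewrite S_INR in Hn.
    pose proof (pos_INR n). nra.
  - apply Cis_series_minus; [apply Cis_series_minus; auto|].
    apply Cis_series_scal; auto.
Qed.

Lemma Cdiff_at_ext_loc (f g : C -> C) (z l : C) (d : R) :
  (0 < d)%R -> (forall h, (Cmod h < d)%R -> f (z + h) = g (z + h)) ->
  Cdiff_at f z l -> Cdiff_at g z l.
Proof.
  intros Hd Hfg [K [d' [Hd' H]]]. exists K, (Rmin d d').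
  split; [now apply Rmin_pos|]. intros h Hh.
  rewrite <- Hfg by (apply Rlt_le_trans with (1 := Hh), Rmin_l).
  assert (H0 : f z = g z).
  { generalize (Hfg 0 ltac:(now rewrite Cmod_0)). now rewrite Cplus_0_r. }
  rewrite <- H0. apply H. apply Rlt_le_trans with (1 := Hh), Rmin_r.
Qed.

Lemma analytic_at_ext_loc (f g : C -> C) (z : C) (d : R) :
  (0 < d)%R -> (forall h, (Cmod h < d)%R -> f (z + h) = g (z + h)) ->
  analytic_at f z -> analytic_at g z.
Proof.
  intros Hd Hfg [rho [a Ha]].
  exists (mkposreal _ (Rmin_pos _ _ Hd (cond_pos rho))), a. simpl. intros y Hy.
  replace (g y) with (f y).
  { apply Ha. apply Rlt_le_trans with (1 := Hy), Rmin_r. }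
  replace y with (z + (y - z)) by ring. apply Hfg.
  apply Rlt_le_trans with (1 := Hy), Rmin_l.
Qed.

Lemma Cdiff_at_translate (f : C -> C) (z0 z l : C) :
  Cdiff_at f (z - z0) l -> Cdiff_at (fun y => f (y - z0)) z l.
Proof.
  intros [K [d [Hd H]]]. exists K, d. split; auto. intros h Hh.
  replace (z + h - z0) with (z - z0 + h) by ring. auto.
Qed.

(** Near [z0] the derivative is given by the differentiated series at [z0], so it
    is analytic at [z0] and the lemma applies to it again. *)
Lemma analytic_at_C_derive (f : C -> C) (z0 : C) :
  analytic_at f z0 ->
  Cdiff_at f z0 (C_derive f z0) /\ analytic_at (C_derive f) z0.
Proof.
  intros Hf. apply analytic_at_geometric in Hf as [a [M [r [Ha [Hr Hf]]]]].
  set (d := (/ (8 * r))%R).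
  assert (Hd : (0 < d)%R) by (apply Rinv_0_lt_compat; lra).
  assert (Hsmall : forall h, (Cmod h < d)%R -> (8 * r * Cmod h < 1)%R).
  { intros h Hh. apply Rmult_lt_compat_l with (r := (8 * r)%R) in Hh; [|lra].
    unfold d in Hh. rewrite Rinv_r in Hh; lra. }
  assert (Hdiff : forall h, (Cmod h < d)%R ->
            Cdiff_at f (z0 + h) (Cpower_series (deriv_coeffs a) h)).
  { intros h Hh.
    apply Cdiff_at_ext_loc with
      (f := fun y => Cpower_series a (y - z0)) (d := (d - Cmod h)%R); [lra| |].
    - intros k Hk. pose proof (Cmod_triangle h k). pose proof (Cmod_ge_0 (h + k)).
      replace (z0 + h + k) with (z0 + (h + k)) by ring. rewrite Hf.
      + f_equal. ring.
      + assert (8 * r * Cmod (h + k) < 1)%R by (apply Hsmall; lra). nra.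
    - apply Cdiff_at_translate. replace (z0 + h - z0) with h by ring.
      apply Cpower_series_diff with M r; auto. }
  assert (Hder : forall h, (Cmod h < d)%R ->
            C_derive f (z0 + h) = Cpower_series (deriv_coeffs a) h).
  { intros h Hh. now apply Cdiff_at_C_derive, Hdiff. }
  split.
  - assert (H0 : (Cmod 0 < d)%R) by now rewrite Cmod_0.
    generalize (Hdiff 0 H0). rewrite <- (Hder 0 H0). now rewrite Cplus_0_r.
  - apply (analytic_at_ext_loc (fun y => Cpower_series (deriv_coeffs a) (y - z0))
             _ z0 d Hd).
    { intros h Hh. rewrite Hder by auto. f_equal. ring. }
    apply analytic_at_geometric.
    exists (deriv_coeffs a), (M * r)%R, (2 * r)%R.
    split; [now apply geometric_deriv_coeffs|]. split; [lra|].
    intros h Hh. f_equal. ring.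
Qed.

(** * Restriction to rays *)

Lemma is_derive_quadratic_remainder (f : R -> R) (x l K d : R) :
  (0 < d)%R ->
  (forall h, Rabs h < d -> Rabs (f (x + h) - f x - h * l) <= K * h ^ 2)%R ->
  is_derive f x l.
Proof.
  intros Hd H. apply is_derive_Reals. intros eps Heps.
  assert (HK : (0 < Rabs K + 1)%R) by (pose proof (Rabs_pos K); lra).
  assert (Hpos : (0 < Rmin d (eps / (Rabs K + 1)))%R).
  { apply Rmin_pos; auto. now apply Rdiv_lt_0_compat. }
  exists (mkposreal _ Hpos). simpl. intros h Hh0 Hh.
  pose proof (Rlt_le_trans _ _ _ Hh (Rmin_l _ _)) as Hh1.
  pose proof (Rlt_le_trans _ _ _ Hh (Rmin_r _ _)) as Hh2.
  replace ((f (x + h) - f x) / h - l)%R with ((f (x + h) - f x - h * l) / h)%R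
    by (field; auto).
  pose proof (Rabs_pos_lt h Hh0) as Hah.
  unfold Rdiv. rewrite Rabs_mult, Rabs_inv.
  apply Rmult_lt_reg_r with (Rabs h); auto.
  rewrite Rmult_assoc, Rinv_l, Rmult_1_r by lra.
  apply Rle_lt_trans with (1 := H h Hh1).
  apply Rmult_lt_compat_l with (r := (Rabs K + 1)%R) in Hh2; auto.
  replace ((Rabs K + 1) * (eps / (Rabs K + 1)))%R with eps in Hh2 by (field; lra).
  pose proof (Rle_abs K).
  replace (h ^ 2)%R with (Rabs h ^ 2)%R by (rewrite RPow_abs, Rabs_pos_eq; nra).
  nra.
Qed.

(** Along the ray of direction [z], the chain rule multiplies the complex
    derivative by [z]. The factor [c] allows for iteration: the second
    derivative along the ray is taken on [z] times the complex derivative. *)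
Lemma is_derive_ray (f : C -> C) (c z l : C) (t : R) :
  Cdiff_at f (t * z) l ->
  is_derive (fun s : R => Re (c * f (s * z))) t (Re (c * (z * l))) /\
  is_derive (fun s : R => Im (c * f (s * z))) t (Im (c * (z * l))).
Proof.
  intros [K [d [Hd H]]].
  set (d' := (d / (Cmod z + 1))%R).
  pose proof (Cmod_ge_0 z) as Hz.
  assert (Hd' : (0 < d')%R) by (apply Rdiv_lt_0_compat; lra).
  assert (Hmain : forall h : R, (Rabs h < d')%R ->
    (Cmod (c * f ((t + h)%R * z) - c * f (t * z) - h * (c * (z * l)))%C
     <= Cmod c * K * Cmod z ^ 2 * h ^ 2)%R).
  { intros h Hh.
    replace (c * f ((t + h)%R * z) - c * f (t * z) - h * (c * (z * l)))
      with (c * (f (t * z + h * z) - f (t * z) - h * z * l))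
      by (rewrite RtoC_plus, Cmult_plus_distr_r; ring).
    rewrite Cmod_mult, !Rmult_assoc.
    apply Rmult_le_compat_l; [apply Cmod_ge_0|].
    assert (Hhz : Cmod (h * z) = (Rabs h * Cmod z)%R) by now rewrite Cmod_mult, Cmod_R.
    replace (Cmod z ^ 2 * h ^ 2)%R with (Cmod (h * z) ^ 2)%R.
    2:{ rewrite Hhz, Rpow_mult_distr, RPow_abs, Rabs_pos_eq by nra. ring. }
    apply H. rewrite Hhz.
    apply Rmult_lt_compat_r with (r := (Cmod z + 1)%R) in Hh; [|lra].
    unfold d' in Hh. replace (d / (Cmod z + 1) * (Cmod z + 1))%R with d in Hh
      by (field; lra).
    pose proof (Rabs_pos h). nra. }
  split; apply is_derive_quadratic_remainder with (K := (Cmod c * K * Cmod z ^ 2)%R)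
    (d := d'); auto; intros h Hh; apply Rle_trans with (2 := Hmain h Hh).
  - apply Rle_trans with (2 := re_le_Cmod _). right. f_equal.
    unfold Cminus. now rewrite !re_plus, !re_opp, re_scal_l.
  - apply Rle_trans with (2 := im_le_Cmod _). right. f_equal.
    unfold Cminus. now rewrite !im_plus, !im_opp, im_scal_l.
Qed.

(** * Exponential, logarithm and inverse hyperbolic sine *)

Lemma Cexp_plus (z w : C) : Cexp (z + w) = Cexp z * Cexp w.
Proof.
  unfold Cexp. rewrite re_plus, im_plus, exp_plus, cos_plus, sin_plus.
  unfold Cmult. simpl. f_equal; ring.
Qed.

Lemma Cexp_0 : Cexp 0 = 1.
Proof.
  unfold Cexp. simpl. rewrite exp_0, cos_0, sin_0. unfold RtoC. f_equal; ring.
Qed.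

Lemma Cexp_opp (z : C) : Cexp z * Cexp (- z) = 1.
Proof. rewrite <- Cexp_plus, <- Cexp_0. f_equal. ring. Qed.

Lemma Cmod_Cexp (z : C) : Cmod (Cexp z) = exp (Re z).
Proof.
  unfold Cmod, Cexp. simpl fst; simpl snd.
  replace ((exp (Re z) * cos (Im z)) ^ 2 + (exp (Re z) * sin (Im z)) ^ 2)%R
    with (exp (Re z) ^ 2)%R.
  - apply sqrt_pow2, Rlt_le, exp_pos.
  - pose proof (sin2_cos2 (Im z)) as H. unfold Rsqr in H.
    transitivity (exp (Re z) ^ 2 * (sin (Im z) * sin (Im z) + cos (Im z) * cos (Im z)))%R;
      [rewrite H|]; ring.
Qed.

Lemma Re_div_Cmod_bound (z : C) : z <> 0 -> (-1 <= Re z / Cmod z <= 1)%R.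
Proof.
  intros Hz. apply Cmod_gt_0 in Hz. pose proof (re_le_Cmod z) as H.
  apply Rabs_le_between in H.
  split; apply Rmult_le_reg_r with (Cmod z); auto; unfold Rdiv;
    rewrite Rmult_assoc, Rinv_l; lra.
Qed.

Lemma Cexp_Clog (z : C) : z <> 0 -> Cexp (Clog z) = z.
Proof.
  intros Hz. pose proof (Re_div_Cmod_bound z Hz) as Hb.
  apply Cmod_gt_0 in Hz.
  assert (Hs : sqrt (1 - Rsqr (Re z / Cmod z)) = (Rabs (Im z) / Cmod z)%R).
  { replace (1 - Rsqr (Re z / Cmod z))%R with (Rsqr (Rabs (Im z) / Cmod z)).
    - apply sqrt_Rsqr, Rdiv_le_0_compat; auto. apply Rabs_pos.
    - unfold Rdiv. rewrite !Rsqr_mult, <- Rsqr_abs.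
      pose proof (Cmod2_alt z) as H. unfold Rsqr.
      field_simplify; [|lra|lra]. rewrite H. field. rewrite <- H. nra. }
  unfold Clog, Cexp. simpl Re. simpl Im. rewrite exp_ln by auto.
  destruct z as [x y]. simpl Re in *. simpl Im in *.
  unfold Carg. simpl Re. simpl Im. destruct (Rle_dec 0 y) as [Hy|Hy].
  - rewrite sin_acos, cos_acos, Hs, Rabs_pos_eq by auto. f_equal; field; lra.
  - rewrite cos_neg, sin_neg, sin_acos, cos_acos, Hs, Rabs_left by (auto || lra).
    f_equal; field; lra.
Qed.

Lemma Carg_bound (z : C) : (Rabs (Carg z) <= PI)%R.
Proof.
  unfold Carg. pose proof (acos_bound (Re z / Cmod z)) as H.
  destruct (Rle_dec 0 (Im z)); rewrite ?Rabs_Ropp, Rabs_pos_eq; lra.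
Qed.

Lemma Carg_bound_Re_nonneg (z : C) :
  z <> 0 -> (0 <= Re z)%R -> (Rabs (Carg z) <= PI / 2)%R.
Proof.
  intros Hz Hre. pose proof (Re_div_Cmod_bound z Hz) as Hb.
  apply Cmod_gt_0 in Hz.
  assert (Hp : (0 <= Re z / Cmod z)%R) by now apply Rdiv_le_0_compat.
  pose proof (acos_bound (Re z / Cmod z)) as H.
  assert (Ha : (acos (Re z / Cmod z) <= PI / 2)%R).
  { apply Rnot_lt_le. intros Hlt.
    pose proof (cos_lt_0 _ Hlt ltac:(lra)) as Hc.
    rewrite cos_acos in Hc by auto. lra. }
  unfold Carg. destruct (Rle_dec 0 (Im z)); rewrite ?Rabs_Ropp, Rabs_pos_eq; lra.
Qed.

Lemma Clog_Cexp (z : C) : (Rabs (Im z) < PI)%R -> Clog (Cexp z) = z.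
Proof.
  intros Hz. apply Rabs_def2 in Hz as [Hz1 Hz2].
  unfold Clog. rewrite Cmod_Cexp, ln_exp. unfold Carg. rewrite Cmod_Cexp.
  destruct z as [x y]. unfold Cexp. simpl Re in *. simpl Im in *.
  pose proof (exp_pos x) as He.
  replace (exp x * cos y / exp x)%R with (cos y) by (field; lra).
  f_equal. destruct (Rle_dec 0 (exp x * sin y)) as [Hs|Hs].
  - assert (0 <= y)%R.
    { apply Rnot_lt_le. intros Hy. apply sin_lt_0_var in Hy; [nra | lra]. }
    apply acos_cos. lra.
  - assert (y < 0)%R.
    { apply Rnot_le_lt. intros Hy. apply Hs.
      pose proof (sin_ge_0 y Hy ltac:(lra)). nra. }
    rewrite <- cos_neg, acos_cos; lra.
Qed.

Lemma sin_ge_cubic (x : R) : (0 <= x <= PI)%R -> (x - x ^ 3 / 6 <= sin x)%R.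
Proof.
  intros Hx. destruct (sin_bound x 0 (proj1 Hx) (proj2 Hx)) as [H _].
  apply Rle_trans with (2 := H). right.
  unfold sin_approx, sin_term. simpl. field.
Qed.

(** Squared form of [c |x| <= |sin x|], where [c] is read off from the cubic lower
    bound of the sine at the end point [b]. *)
Lemma sin_sqr_ge (c x b : R) :
  (0 <= c)%R -> (0 <= b <= PI)%R -> (c <= 1 - b ^ 2 / 6)%R -> (Rabs x <= b)%R ->
  ((c * x) ^ 2 <= sin x ^ 2)%R.
Proof.
  intros Hc Hb Hcb Hx.
  assert (Hs : (sin (Rabs x) ^ 2 = sin x ^ 2)%R).
  { unfold Rabs. destruct (Rcase_abs x); [rewrite sin_neg|]; ring. }
  rewrite <- Hs.
  replace ((c * x) ^ 2)%R with ((c * Rabs x) ^ 2)%R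
    by (rewrite !Rpow_mult_distr, pow2_abs; ring).
  pose proof (Rabs_pos x) as H0.
  pose proof (sin_ge_cubic (Rabs x) ltac:(lra)) as Hcub.
  apply pow_incr. split; [nra|].
  apply Rle_trans with (2 := Hcub).
  assert (Rabs x ^ 2 <= b ^ 2)%R by (apply pow_incr; lra).
  replace (Rabs x - Rabs x ^ 3 / 6)%R with ((1 - Rabs x ^ 2 / 6) * Rabs x)%R by field.
  apply Rmult_le_compat_r; lra.
Qed.

Lemma Cmod_le_sqr (z : C) (k : R) (w : C) :
  (0 <= k)%R -> (Re z ^ 2 + Im z ^ 2 <= k ^ 2 * Cmod w ^ 2)%R -> (Cmod z <= k * Cmod w)%R.
Proof.
  intros Hk H. pose proof (Cmod_ge_0 z). pose proof (Cmod_ge_0 w).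
  rewrite <- Cmod2_alt in H. rewrite <- Rpow_mult_distr in H.
  apply Rsqr_incr_0; unfold Rsqr; try nra.
Qed.

Lemma Csqrt_sqr (z : C) : z <> 0 -> Csqrt z * Csqrt z = z.
Proof.
  intros Hz. unfold Csqrt. rewrite <- Cexp_plus.
  replace (Clog z / 2 + Clog z / 2) with (Clog z) by field.
  now apply Cexp_Clog.
Qed.

Lemma Re_Csqrt_nonneg (z : C) : (0 <= Re (Csqrt z))%R.
Proof.
  unfold Csqrt, Cexp. simpl Re at 1.
  apply Rmult_le_pos; [apply Rlt_le, exp_pos|].
  replace (Im (Clog z / 2)) with (Carg z / 2)%R.
  - pose proof (Carg_bound z) as H. apply Rabs_le_between in H.
    apply cos_ge_0; lra.
  - unfold Clog, Cdiv. rewrite im_mult. unfold Cinv. simpl. field.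
Qed.

(** The number [w + sqrt (1 + w ^ 2)] and its inverse [sqrt (1 + w ^ 2) - w] have
    real parts of the same sign, and their sum has nonnegative real part; so the
    imaginary part of [Casinh w] stays in [[-PI/2, PI/2]]. *)
Lemma Casinh_spec (w : C) :
  (Cmod w < 1)%R ->
  Cexp (Casinh w) - Cexp (- Casinh w) = 2 * w /\ (Rabs (Im (Casinh w)) <= PI / 2)%R.
Proof.
  intros Hw.
  assert (H1 : 1 + w ^ 2 <> 0).
  { intros H. pose proof (Cmod_ge_0 w).
    assert (Hm : Cmod (w ^ 2) = 1%R).
    { replace (w ^ 2) with (- (1)); [now rewrite Cmod_opp, Cmod_1|].
      replace (w ^ 2) with (1 + w ^ 2 - 1) by ring. rewrite H. ring. }
    rewrite Cmod_pow in Hm. nra. }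
  unfold Casinh. set (s := Csqrt (1 + w ^ 2)).
  assert (Hs : s * s = 1 + w ^ 2) by now apply Csqrt_sqr.
  assert (Hre : (0 <= Re s)%R) by apply Re_Csqrt_nonneg.
  assert (Hinv : (w + s) * (s - w) = 1).
  { replace ((w + s) * (s - w)) with (s * s - w ^ 2) by ring. rewrite Hs. ring. }
  assert (Hv : w + s <> 0).
  { intros H. rewrite H, Cmult_0_l in Hinv. now apply C1_nz. }
  assert (Hexp : Cexp (Clog (w + s)) = w + s) by now apply Cexp_Clog.
  split.
  - assert (Hexp' : Cexp (- Clog (w + s)) = s - w).
    { pose proof (Cexp_opp (Clog (w + s))) as H. rewrite Hexp in H.
      replace (s - w) with ((w + s) * (s - w) / (w + s)) by (field; auto).
      rewrite Hinv, <- H. field. auto. }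
    rewrite Hexp, Hexp'. ring.
  - simpl Im. apply Carg_bound_Re_nonneg; auto.
    destruct w as [a b]. destruct s as [c d].
    injection Hinv as Hi1 Hi2. simpl in *. apply Rnot_lt_le. intros Hneg.
    assert (Hc : ((c - a) * ((a + c) ^ 2 + (b + d) ^ 2) = a + c)%R).
    { replace ((c - a) * ((a + c) ^ 2 + (b + d) ^ 2))%R
        with ((a + c) * ((a + c) * (c + - a) - (b + d) * (d + - b))
              + (b + d) * ((a + c) * (d + - b) + (b + d) * (c + - a)))%R by ring.
      rewrite Hi1, Hi2. ring. }
    assert (0 <= (c - a) * ((a + c) ^ 2 + (b + d) ^ 2))%R by (apply Rmult_le_pos; nra).
    lra.
Qed.

(** With [Casinh w = x + i y] one has [|w|^2 = sinh x ^ 2 + sin y ^ 2], where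
    [|sinh x| >= |x| / 2], and [|sin y| >= |y| / 3] because [|y| <= PI/2 <= 2]. *)
Lemma Casinh_bound (w : C) : (Cmod w < 1)%R -> (Cmod (Casinh w) <= 3 * Cmod w)%R.
Proof.
  intros Hw. destruct (Casinh_spec w Hw) as [H Him].
  revert H Him. generalize (Casinh w). intros z H Him.
  apply Cmod_le_sqr; [lra|]. rewrite Cmod2_alt.
  destruct z as [x y]. destruct w as [a b]. unfold Cexp in H.
  injection H as Ha Hb. simpl Re in *. simpl Im in *.
  rewrite cos_neg in Ha. rewrite sin_neg in Hb.
  pose proof PI_4. pose proof PI2_3_2.
  (* [1 - 2 ^ 2 / 6 = 1/3] *)
  pose proof (sin_sqr_ge (/ 3) y 2 ltac:(lra) ltac:(lra) ltac:(lra) ltac:(lra)) as Hsin.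
  pose proof (sin2_cos2 y) as Hsc. unfold Rsqr in Hsc.
  pose proof (exp_ineq1_le x) as E1. pose proof (exp_ineq1_le (- x)) as E2.
  assert (Hprod : (exp x * exp (- x) = 1)%R).
  { rewrite <- exp_plus, Rplus_opp_r. apply exp_0. }
  pose proof (exp_pos x) as P1. pose proof (exp_pos (- x)) as P2.
  set (e := exp x) in *. set (g := exp (- x)) in *.
  assert (Hx : (x ^ 2 <= (e - g) ^ 2)%R).
  { destruct (Rle_dec 0 x) as [Hx|Hx].
    - assert (g <= 1)%R by nra. nra.
    - assert (e <= 1)%R by nra. nra. }
  assert (Ea : (2 * a = (e - g) * cos y)%R) by lra.
  assert (Eb : (2 * b = (e + g) * sin y)%R) by lra.
  assert (Hsum : (4 * (a ^ 2 + b ^ 2) = (e - g) ^ 2 + 4 * sin y ^ 2)%R).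
  { replace (4 * (a ^ 2 + b ^ 2))%R with ((2 * a) ^ 2 + (2 * b) ^ 2)%R by ring.
    rewrite Ea, Eb.
    replace (((e - g) * cos y) ^ 2 + ((e + g) * sin y) ^ 2)%R
      with ((e - g) ^ 2 * (sin y * sin y + cos y * cos y)
            + 4 * (e * g) * sin y ^ 2)%R by ring.
    rewrite Hsc, Hprod. ring. }
  nra.
Qed.

(** With [Clog (1 + u) = x + i y] one has
    [|u|^2 = (exp x - 1) ^ 2 + 4 exp x sin (y/2) ^ 2], where [exp x >= 1/2]. *)
Lemma Clog_1_plus_bound (u : C) :
  (Cmod u <= / 2)%R -> (Cmod (Clog (1 + u)) <= 2 * Cmod u)%R.
Proof.
  intros Hu.
  assert (Hre : (/ 2 <= Re (1 + u))%R).
  { rewrite re_plus, re_RtoC. pose proof (re_le_Cmod u) as H.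
    apply Rabs_le_between in H. lra. }
  assert (Hv : 1 + u <> 0).
  { intros H. rewrite H in Hre. simpl in Hre. lra. }
  assert (Him : (Rabs (Im (Clog (1 + u))) <= PI / 2)%R)
    by (apply Carg_bound_Re_nonneg; auto; lra).
  assert (He : (/ 2 <= exp (Re (Clog (1 + u))))%R).
  { rewrite <- Cmod_Cexp, Cexp_Clog by auto.
    apply Rle_trans with (1 := Hre). apply Rle_trans with (2 := re_le_Cmod _).
    apply Rle_abs. }
  assert (H : u = Cexp (Clog (1 + u)) - 1) by (rewrite Cexp_Clog by auto; ring).
  revert H Him He. generalize (Clog (1 + u)). intros z H Him He.
  apply Cmod_le_sqr; [lra|]. rewrite Cmod2_alt.
  destruct z as [x y]. destruct u as [a b]. unfold Cexp in H.
  injection H as Ha Hb. simpl Re in *. simpl Im in *.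
  pose proof PI_4. pose proof PI2_3_2.
  assert (Hy2 : (Rabs (y / 2) <= 1)%R).
  { unfold Rdiv. rewrite Rabs_mult, (Rabs_pos_eq (/ 2)); lra. }
  (* [1 - 1 ^ 2 / 6 = 5/6], and [|y / 2| <= PI/4 <= 1] *)
  pose proof (sin_sqr_ge (5 / 6) (y / 2) 1 ltac:(lra) ltac:(lra) ltac:(lra) Hy2) as Hsin.
  pose proof (exp_ineq1_le x) as E1. pose proof (exp_ineq1_le (- x)) as E2.
  assert (Hprod : (exp x * exp (- x) = 1)%R).
  { rewrite <- exp_plus, Rplus_opp_r. apply exp_0. }
  pose proof (sin2_cos2 y) as Hsc. unfold Rsqr in Hsc.
  assert (Hcos : cos y = (1 - 2 * sin (y / 2) ^ 2)%R).
  { replace y with (2 * (y / 2))%R at 1 by field. rewrite cos_2a_sin. ring. }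
  set (e := exp x) in *. set (g := exp (- x)) in *.
  assert (Hx : (x ^ 2 <= 4 * (e - 1) ^ 2)%R).
  { destruct (Rle_dec 0 x) as [Hx|Hx]; [nra|].
    (* from [1 - x <= exp (- x)], multiplied by [exp x] *)
    assert (e * (1 - x) <= 1)%R by nra.
    assert (- x <= 2 * (1 - e))%R by nra. nra. }
  assert (Hsum : (a ^ 2 + b ^ 2 = (e - 1) ^ 2 + 4 * e * sin (y / 2) ^ 2)%R).
  { rewrite Ha, Hb.
    replace ((e * cos y + - (1)) ^ 2 + (e * sin y + - 0) ^ 2)%R
      with (e ^ 2 * (sin y * sin y + cos y * cos y) - 2 * e * cos y + 1)%R by ring.
    rewrite Hsc, Hcos. ring. }
  nra.
Qed.

(** * The logarithm of an analytic function *)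

Lemma course_of_values {A : Type} (d : A) (F : nat -> (nat -> A) -> A) :
  (forall n c c', (forall k, (k < n)%nat -> c k = c' k) -> F n c = F n c') ->
  exists c : nat -> A, forall n, c n = F n c.
Proof.
  intros HF.
  set (P := fix P (n : nat) : nat -> A :=
    match n with
    | O => fun _ => d
    | S m => fun k => if Nat.eqb k m then F m (P m) else P m k
    end).
  assert (HP : forall n k, (k < n)%nat -> P n k = P (S k) k).
  { induction n as [|n IH]; intros k Hk; [lia|].
    destruct (Nat.eq_dec k n) as [->|Hne]; [reflexivity|].
    simpl. rewrite (proj2 (Nat.eqb_neq k n) Hne), IH by lia.
    simpl. reflexivity. }
  exists (fun k => P (S k) k). intros n.
  transitivity (F n (P n)).
  - simpl. now rewrite Nat.eqb_refl.
  - apply HF. intros k Hk. now apply HP.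
Qed.

Fixpoint Csum_lt (u : nat -> C) (n : nat) : C :=
  match n with O => 0 | S m => Csum_lt u m + u m end.

Lemma Csum_lt_ext (u v : nat -> C) (n : nat) :
  (forall k, (k < n)%nat -> u k = v k) -> Csum_lt u n = Csum_lt v n.
Proof.
  induction n as [|n IH]; intros H; [reflexivity|].
  simpl. rewrite H, IH; auto with arith.
Qed.

Lemma sum_n_Csum_lt (u : nat -> C) (n : nat) :
  @sum_n C_AbelianMonoid u n = Csum_lt u n + u n.
Proof.
  induction n as [|n IH].
  - rewrite sum_O. simpl. ring.
  - rewrite sum_Sn, IH. reflexivity.
Qed.

Lemma Csum_lt_geometric_bound (u : nat -> C) (B s : R) (n : nat) :
  (1 <= s)%R -> (forall k, (k < n)%nat -> (Cmod (u k) <= B * s ^ k)%R) ->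
  ((s - 1) * Cmod (Csum_lt u n) <= B * (s ^ n - 1))%R.
Proof.
  intros Hs. induction n as [|n IH]; intros H.
  - simpl. rewrite Cmod_0. lra.
  - specialize (IH ltac:(auto with arith)). specialize (H n ltac:(lia)).
    simpl. pose proof (Cmod_triangle (Csum_lt u n) (u n)). nra.
Qed.

(** Coefficients [c] of the logarithmic derivative of the power series [a]. They
    are determined recursively by the Cauchy product [c * a = a'], and the
    recursion itself yields a geometric bound. *)
Lemma log_derivative_coeffs (a : nat -> C) (M r : R) :
  geometric a M r -> (0 < r)%R -> a 0%nat <> 0 ->
  exists (c : nat -> C) (A s : R), (0 < s)%R /\ geometric c A s /\
    forall n, @sum_n C_AbelianMonoid (fun k => c k * a (n - k)%nat) n = deriv_coeffs a n.
Proof.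
  intros Ha Hr Ha0.
  destruct (course_of_values (RtoC 0) (fun n c =>
    (deriv_coeffs a n - Csum_lt (fun k => c k * a (n - k)%nat) n) / a 0%nat))
    as [c Hc].
  { intros n c c' H. do 2 f_equal. apply Csum_lt_ext.
    intros k Hk. now rewrite H. }
  pose proof (proj1 (Cmod_gt_0 _) Ha0) as Hm.
  set (N := (M / Cmod (a 0%nat))%R).
  assert (HMN : (M = N * Cmod (a 0%nat))%R) by (unfold N; field; lra).
  assert (HN : (1 <= N)%R).
  { generalize (Ha 0%nat). simpl. intros H.
    apply Rmult_le_reg_r with (Cmod (a 0%nat)); auto. lra. }
  (* The ratio [s] makes the convolution sum at most half of the bound on [c n]:
     [N * (s ^ n - 1) / (s - 1) <= s ^ n / 2]. *)
  set (s := (2 * N + 1)%R).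
  exists c, (2 * N * r)%R, (s * r)%R. split; [unfold s; nra|]. split.
  - intros n. induction n as [n IH] using (well_founded_induction Wf_nat.lt_wf).
    set (S := Csum_lt (fun k => c k * a (n - k)%nat) n).
    assert (Hsum : ((s - 1) * Cmod S <= 2 * N * r * M * r ^ n * (s ^ n - 1))%R).
    { apply Csum_lt_geometric_bound; [unfold s; lra|].
      intros k Hk. rewrite Cmod_mult.
      replace (2 * N * r * M * r ^ n * s ^ k)%R
        with (2 * N * r * (s * r) ^ k * (M * r ^ (n - k)))%R.
      - apply Rmult_le_compat; auto using Cmod_ge_0.
      - replace (r ^ n)%R with (r ^ k * r ^ (n - k))%R.
        + rewrite Rpow_mult_distr. ring.
        + rewrite <- pow_add. f_equal. lia. }
    assert (HS : (Cmod S <= r * M * r ^ n * (s ^ n - 1))%R).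
    { apply Rmult_le_reg_l with (s - 1)%R; [unfold s; lra|].
      apply Rle_trans with (1 := Hsum). right. unfold s. ring. }
    pose proof (geometric_deriv_coeffs a M r Ha n) as Hd.
    rewrite Hc, Cmod_div by auto. fold S.
    apply Rmult_le_reg_r with (Cmod (a 0%nat)); auto.
    unfold Rdiv. rewrite Rmult_assoc, Rinv_l, Rmult_1_r by lra.
    apply Rle_trans with (Cmod (deriv_coeffs a n) + Cmod S)%R.
    { unfold Cminus. rewrite <- (Cmod_opp S). apply Cmod_triangle. }
    replace (2 * N * r * (s * r) ^ n * Cmod (a 0%nat))%R
      with (M * r * r ^ n * (s ^ n + s ^ n))%R
      by (rewrite HMN, Rpow_mult_distr; ring).
    rewrite Rpow_mult_distr in Hd.
    assert (2 ^ n <= s ^ n)%R by (apply pow_incr; unfold s; lra).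
    assert (0 < M * r * r ^ n)%R.
    { pose proof (pow_lt r n Hr). assert (0 < M)%R by nra.
      apply Rmult_lt_0_compat; nra. }
    nra.
  - intros n. rewrite sum_n_Csum_lt, Nat.sub_diag.
    rewrite (Hc n). set (S := Csum_lt (fun k => c k * a (n - k)%nat) n).
    change (S + (deriv_coeffs a n - S) / a 0%nat * a 0%nat = deriv_coeffs a n).
    field. auto.
Qed.

Lemma geometric_weaken (a : nat -> C) (M r r' : R) :
  geometric a M r -> (0 <= r <= r')%R -> geometric a M r'.
Proof.
  intros Ha Hr n. apply Rle_trans with (1 := Ha n).
  apply Rmult_le_compat_l.
  - generalize (Ha 0%nat) (Cmod_ge_0 (a 0%nat)). simpl. lra.
  - now apply pow_incr.
Qed.

Lemma Cpower_series_0 (a : nat -> C) (M r : R) :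
  geometric a M r -> (0 <= r)%R -> Cpower_series a 0 = a 0%nat.
Proof.
  intros Ha Hr. apply (Cis_series_unique (fun n => a n * 0 ^ n)).
  - apply (Cpower_series_correct a M r); auto. rewrite Cmod_0. lra.
  - apply filterlim_ext with (f := fun _ : nat => a 0%nat).
    + intros n. symmetry. induction n as [|n IH].
      * rewrite sum_O. simpl. ring.
      * rewrite sum_Sn, IH.
        change (a 0%nat + a (S n) * (0 * 0 ^ n) = a 0%nat). ring.
    + apply filterlim_const.
Qed.

Lemma Cpower_series_mult (a b c : nat -> C) (Ma Mb Mc r : R) (h : C) :
  geometric a Ma r -> geometric b Mb r -> geometric c Mc (2 * r) -> (0 <= r)%R ->
  (2 * r * Cmod h < 1)%R ->
  (forall n, @sum_n C_AbelianMonoid (fun k => a k * b (n - k)%nat) n = c n) ->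
  Cpower_series a h * Cpower_series b h = Cpower_series c h.
Proof.
  intros Ha Hb Hc Hr Hh Hconv.
  pose proof (Rmult_le_pos _ _ Hr (Cmod_ge_0 h)) as Hrh.
  apply (Cis_series_unique (fun n => c n * h ^ n)).
  2:{ apply (Cpower_series_correct c Mc (2 * r)); auto. lra. }
  apply Cis_series_ext with (fun n => @sum_n C_AbelianMonoid
    (fun k => (a k * h ^ k) * (b (n - k)%nat * h ^ (n - k))) n).
  - intros n. rewrite <- Hconv.
    etransitivity; [|apply (sum_n_mult_r (K := C_Ring))].
    apply (sum_n_ext_loc (G := C_AbelianMonoid)). intros k Hk.
    change (a k * h ^ k * (b (n - k)%nat * h ^ (n - k))
            = a k * b (n - k)%nat * h ^ n).
    replace (h ^ n) with (h ^ k * h ^ (n - k)); [ring|].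
    rewrite <- Cpow_add_r. f_equal. lia.
  - apply (Cis_series_mult (fun n => a n * h ^ n) (fun n => b n * h ^ n)
             _ _ Ma Mb (r * Cmod h)); [lra|..].
    + now apply geometric_terms.
    + now apply geometric_terms.
    + apply (Cpower_series_correct a Ma r); auto; lra.
    + apply (Cpower_series_correct b Mb r); auto; lra.
Qed.

(** A complex function [f] and a solution [l] of [f' = l' f] satisfy
    [(f exp (- l))' = 0]; the two real functions below are the components of
    [f exp (- l)] along a segment. *)
Lemma twisted_exp_constant (u v x y u' v' x' y' : R -> R) :
  (forall t, 0 <= t <= 1 ->
     is_derive u t (u' t) /\ is_derive v t (v' t) /\
     is_derive x t (x' t) /\ is_derive y t (y' t) /\
     u' t = x' t * u t - y' t * v t /\ v' t = x' t * v t + y' t * u t)%R ->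
  (exp (- x 1) * (u 1 * cos (y 1) + v 1 * sin (y 1))
   = exp (- x 0) * (u 0 * cos (y 0) + v 0 * sin (y 0)))%R /\
  (exp (- x 1) * (v 1 * cos (y 1) - u 1 * sin (y 1))
   = exp (- x 0) * (v 0 * cos (y 0) - u 0 * sin (y 0)))%R.
Proof.
  intros H.
  split; symmetry.
  - apply (eq_is_derive
      (fun t => exp (- x t) * (u t * cos (y t) + v t * sin (y t)))%R); [|lra].
    intros t Ht. destruct (H t Ht) as (Du & Dv & Dx & Dy & Eu & Ev).
    auto_derive.
    + repeat split; eexists; eassumption.
    + rewrite (is_derive_unique (fun s : R => u s) t _ Du).
      rewrite (is_derive_unique (fun s : R => v s) t _ Dv).
      rewrite (is_derive_unique (fun s : R => x s) t _ Dx).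
      rewrite (is_derive_unique (fun s : R => y s) t _ Dy).
      rewrite Eu, Ev. unfold zero. simpl. ring.
  - apply (eq_is_derive
      (fun t => exp (- x t) * (v t * cos (y t) - u t * sin (y t)))%R); [|lra].
    intros t Ht. destruct (H t Ht) as (Du & Dv & Dx & Dy & Eu & Ev).
    auto_derive.
    + repeat split; eexists; eassumption.
    + rewrite (is_derive_unique (fun s : R => u s) t _ Du).
      rewrite (is_derive_unique (fun s : R => v s) t _ Dv).
      rewrite (is_derive_unique (fun s : R => x s) t _ Dx).
      rewrite (is_derive_unique (fun s : R => y s) t _ Dy).
      rewrite Eu, Ev. unfold zero. simpl. ring.
Qed.

Lemma Cexp_primitive (f l f' l' : C -> C) (h : C) :
  (forall t : R, (0 <= t <= 1)%R ->
     Cdiff_at f (t * h) (f' (t * h)) /\ Cdiff_at l (t * h) (l' (t * h)) /\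
     f' (t * h) = l' (t * h) * f (t * h)) ->
  f h * Cexp (- l h) = f 0 * Cexp (- l 0).
Proof.
  intros H.
  destruct (twisted_exp_constant
    (fun t => Re (1 * f (t * h))) (fun t => Im (1 * f (t * h)))
    (fun t => Re (1 * l (t * h))) (fun t => Im (1 * l (t * h)))
    (fun t => Re (1 * (h * f' (t * h)))) (fun t => Im (1 * (h * f' (t * h))))
    (fun t => Re (1 * (h * l' (t * h)))) (fun t => Im (1 * (h * l' (t * h)))))
    as [Hr Hi].
  { intros t Ht. destruct (H t Ht) as (Df & Dl & E).
    destruct (is_derive_ray f 1 h _ t Df). destruct (is_derive_ray l 1 h _ t Dl).
    do 4 (split; [assumption|]). rewrite E.
    rewrite !Cmult_1_l, (Cmult_assoc h), !im_mult, !re_mult, !im_mult. split; ring. }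
  revert Hr Hi. rewrite !Cmult_1_l, !Cmult_0_l.
  generalize (f h) (l h) (f 0) (l 0). intros [u v] [x y] [u0 v0] [x0 y0].
  simpl. intros Hr Hi. unfold Cexp, Cmult. simpl.
  rewrite !cos_neg, !sin_neg. f_equal; lra.
Qed.

Lemma Cdiff_at_continuous (f : C -> C) (z l : C) (eps : R) :
  Cdiff_at f z l -> (0 < eps)%R ->
  exists d : R, (0 < d)%R /\
    forall h, (Cmod h < d)%R -> (Cmod (f (z + h) - f z)%C < eps)%R.
Proof.
  intros [K [d [Hd H]]] Heps.
  set (B := (Rabs K + Cmod l + 1)%R).
  assert (HB : (0 < B)%R).
  { unfold B. pose proof (Rabs_pos K). pose proof (Cmod_ge_0 l). lra. }
  exists (Rmin d (Rmin 1 (eps / B))). split.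
  { repeat apply Rmin_pos; try lra. now apply Rdiv_lt_0_compat. }
  intros h Hh.
  pose proof (Rlt_le_trans _ _ _ Hh (Rmin_l _ _)) as H1.
  pose proof (Rlt_le_trans _ _ _ Hh (Rmin_r _ _)) as H23.
  pose proof (Rlt_le_trans _ _ _ H23 (Rmin_l _ _)) as H2.
  pose proof (Rlt_le_trans _ _ _ H23 (Rmin_r _ _)) as H3.
  specialize (H h H1).
  replace (f (z + h) - f z) with (f (z + h) - f z - h * l + h * l) by ring.
  apply Rle_lt_trans with (1 := Cmod_triangle _ _). rewrite (Cmod_mult h l).
  apply Rmult_lt_compat_l with (r := B) in H3; auto.
  replace (B * (eps / B))%R with eps in H3 by (field; lra).
  apply Rle_lt_trans with (2 := H3). unfold B.
  pose proof (Rle_abs K). pose proof (Rabs_pos K). pose proof (Cmod_ge_0 h).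
  assert (K * Cmod h ^ 2 <= Rabs K * Cmod h)%R.
  { apply Rle_trans with (Rabs K * Cmod h ^ 2)%R;
      [apply Rmult_le_compat_r | apply Rmult_le_compat_l]; nra. }
  nra.
Qed.

(** Near a point where [Re f] is positive, the power series obtained by
    integrating the logarithmic derivative is an exact logarithm of [f]; by
    continuity it stays within the strip where the principal branch inverts
    the exponential. *)
Lemma analytic_at_Clog (f : C -> C) (z0 : C) :
  analytic_at f z0 -> (0 < Re (f z0))%R -> analytic_at (fun z => Clog (f z)) z0.
Proof.
  intros Hf Hre. apply analytic_at_geometric in Hf as [a [M [r [Ha [Hr Hf]]]]].
  assert (Hf0 : f z0 = a 0%nat).
  { rewrite <- (Cpower_series_0 a M r Ha (Rlt_le _ _ Hr)), <- Hf.
    - f_equal. ring.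
    - rewrite Cmod_0. lra. }
  rewrite Hf0 in Hre.
  assert (Ha0 : a 0%nat <> 0).
  { intros H. rewrite H in Hre. simpl in Hre. lra. }
  destruct (log_derivative_coeffs a M r Ha Hr Ha0) as [c [A [s [Hs [Hc Hconv]]]]].
  set (l := fun n => match n with O => Clog (a 0%nat) | S m => c m / INR (S m) end).
  assert (Hdl : forall n, deriv_coeffs l n = c n).
  { intros n. unfold deriv_coeffs, l. field.
    intros H. apply RtoC_inj in H. now apply (not_0_INR (S n)) in H. }
  set (L := (Cmod (Clog (a 0%nat)) + A / s)%R).
  set (rho := (r + s)%R).
  assert (HA : (0 <= A / s)%R).
  { generalize (Hc 0%nat) (Cmod_ge_0 (c 0%nat)). simpl. intros.
    apply Rdiv_le_0_compat; lra. }
  assert (Hl : geometric l L s).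
  { intros [|n]; unfold L.
    - simpl. lra.
    - apply Rle_trans with (A / s * s ^ S n)%R.
      2:{ apply Rmult_le_compat_r; [apply pow_le; lra|].
          pose proof (Cmod_ge_0 (Clog (a 0%nat))). lra. }
      replace (A / s * s ^ S n)%R with (A * s ^ n)%R by (simpl; field; lra).
      apply Rle_trans with (2 := Hc n). rewrite <- Hdl. unfold deriv_coeffs.
      rewrite Cmod_mult, Cmod_R, Rabs_pos_eq by apply pos_INR.
      pose proof (Cmod_ge_0 (l (S n))). pose proof (pos_INR n).
      rewrite S_INR. nra. }
  assert (Ha' : geometric a M rho) by (apply geometric_weaken with r; unfold rho; auto; lra).
  assert (Hc' : geometric c A rho) by (apply geometric_weaken with s; unfold rho; auto; lra).
  assert (Hl' : geometric l L rho) by (apply geometric_weaken with s; unfold rho; auto; lra).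
  assert (Hrho : (0 < rho)%R) by (unfold rho; lra).
  assert (Hderl : forall z, Cpower_series (deriv_coeffs l) z = Cpower_series c z).
  { intros z. unfold Cpower_series.
    f_equal; apply Series_ext; intros n; now rewrite Hdl. }
  assert (Hexp : forall h, (8 * rho * Cmod h < 1)%R ->
            Cpower_series a h = Cexp (Cpower_series l h)).
  { intros h Hh.
    assert (H1 : Cpower_series a h * Cexp (- Cpower_series l h) = 1).
    { rewrite (Cexp_primitive (Cpower_series a) (Cpower_series l)
        (Cpower_series (deriv_coeffs a)) (Cpower_series c)).
      - rewrite (Cpower_series_0 a M rho), (Cpower_series_0 l L rho)
          by (auto; lra).
        simpl. rewrite <- (Cexp_Clog (a 0%nat)) at 1 by auto. apply Cexp_opp.
      - intros t Ht.
        assert (Hth : (8 * rho * Cmod (t * h) < 1)%R).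
        { apply Rle_lt_trans with (2 := Hh). apply Rmult_le_compat_l; [lra|].
          rewrite Cmod_mult, Cmod_R, Rabs_pos_eq by lra.
          pose proof (Cmod_ge_0 h). nra. }
        split; [now apply Cpower_series_diff with M rho|]. split.
        { rewrite <- Hderl. now apply Cpower_series_diff with L rho. }
        symmetry.
        apply (Cpower_series_mult c a (deriv_coeffs a) A M (M * rho) rho); auto.
        + now apply geometric_deriv_coeffs.
        + lra.
        + pose proof (Cmod_ge_0 (t * h)). nra. }
    transitivity (Cpower_series a h * Cexp (- Cpower_series l h)
                  * Cexp (Cpower_series l h)).
    - rewrite <- Cmult_assoc, (Cmult_comm (Cexp (- _))), Cexp_opp. ring.
    - rewrite H1. ring. }
  assert (Hdl0 : Cdiff_at (Cpower_series l) 0 (Cpower_series (deriv_coeffs l) 0)).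
  { apply Cpower_series_diff with L rho; auto. rewrite Cmod_0. lra. }
  pose proof PI2_3_2.
  destruct (Cdiff_at_continuous _ _ _ (PI / 2) Hdl0 ltac:(lra)) as [d [Hd Hcont]].
  set (e := Rmin d (/ (8 * rho))).
  assert (He : (0 < e)%R).
  { apply Rmin_pos; auto. apply Rinv_0_lt_compat. lra. }
  apply (analytic_at_ext_loc (fun z => Cpower_series l (z - z0)) _ z0 e He).
  - intros h Hh. replace (z0 + h - z0) with h by ring.
    pose proof (Rlt_le_trans _ _ _ Hh (Rmin_l _ _)) as Hhd.
    pose proof (Rlt_le_trans _ _ _ Hh (Rmin_r _ _)) as Hhr.
    apply Rmult_lt_compat_l with (r := (8 * rho)%R) in Hhr; [|lra].
    rewrite Rinv_r in Hhr by lra.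
    assert (Hrh : (r * Cmod h < 1)%R).
    { pose proof (Rmult_le_pos r _ (Rlt_le _ _ Hr) (Cmod_ge_0 h)).
      pose proof (Rmult_le_pos s _ (Rlt_le _ _ Hs) (Cmod_ge_0 h)).
      unfold rho in Hhr. lra. }
    rewrite (Hf h Hrh).
    rewrite (Hexp h Hhr). symmetry. apply Clog_Cexp.
    specialize (Hcont h Hhd). rewrite Cplus_0_l in Hcont.
    rewrite (Cpower_series_0 l L rho Hl' (Rlt_le _ _ Hrho)) in Hcont.
    pose proof (Rle_lt_trans _ _ _ (im_le_Cmod _) Hcont) as Him.
    unfold Cminus in Him. rewrite im_plus, im_opp in Him.
    pose proof (Carg_bound_Re_nonneg (a 0%nat) Ha0 (Rlt_le _ _ Hre)) as H0.
    change (Im (l 0%nat)) with (Carg (a 0%nat)) in Him.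
    apply Rabs_def2 in Him. apply Rabs_le_between in H0. apply Rabs_def1; lra.
  - apply analytic_at_geometric. exists l, L, rho.
    split; auto. split; auto. intros h _. f_equal. ring.
Qed.

(** * The Euler differential operator on a segment *)

(** For [q = U + i V], [q + g1 t q' + g2 t^2 q'' = h] and [d = g1 - g2], the energy
    [(g2 |t q'|^2 + |q|^2) / 2] has derivative at most [k^2 t / (4 d)]: pair the
    equation with [t q'] and complete the square. The function [E] of the proof is
    twice this energy minus the integral of twice that bound, hence it is
    nonincreasing. *)
Lemma euler_operator_energy_bound (g1 g2 k : R) (U U1 U2 V V1 V2 : R -> R) :
  (0 < g2 < g1)%R ->
  (forall t, 0 <= t <= 1 ->
     is_derive U t (U1 t) /\ is_derive U1 t (U2 t) /\
     is_derive V t (V1 t) /\ is_derive V1 t (V2 t))%R ->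
  U 0%R = 0%R -> V 0%R = 0%R ->
  (forall t, 0 <= t <= 1 ->
     (U t + g1 * t * U1 t + g2 * t ^ 2 * U2 t) ^ 2
     + (V t + g1 * t * V1 t + g2 * t ^ 2 * V2 t) ^ 2 <= (k * t) ^ 2)%R ->
  (U 1 ^ 2 + V 1 ^ 2 <= k ^ 2 / (4 * (g1 - g2)))%R.
Proof.
  intros Hg HD HU0 HV0 Hh.
  set (d := (g1 - g2)%R).
  set (E := fun t : R => (g2 * (t ^ 2 * (U1 t ^ 2 + V1 t ^ 2)) + (U t ^ 2 + V t ^ 2)
                          - k ^ 2 * t ^ 2 / (4 * d))%R).
  set (E' := fun t : R => (2 * g2 * (t * (U1 t ^ 2 + V1 t ^ 2)
                 + t ^ 2 * (U1 t * U2 t + V1 t * V2 t))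
               + 2 * (U t * U1 t + V t * V1 t) - k ^ 2 * t / (2 * d))%R).
  assert (HE : forall t, (0 <= t <= 1)%R -> is_derive E t (E' t)).
  { intros t Ht. destruct (HD t Ht) as (D0 & D1 & D2 & D3).
    unfold E. auto_derive.
    - repeat split; eexists; eassumption.
    - rewrite (is_derive_unique (fun s : R => U s) t _ D0).
      rewrite (is_derive_unique (fun s : R => U1 s) t _ D1).
      rewrite (is_derive_unique (fun s : R => V s) t _ D2).
      rewrite (is_derive_unique (fun s : R => V1 s) t _ D3).
      unfold E', d. field. lra. }
  assert (HE' : forall t, (0 <= t <= 1)%R -> (E' t <= 0)%R).
  { intros t [Ht0 Ht1]. destruct Ht0 as [Ht0|<-].
    2:{ unfold E'. rewrite HU0, HV0. right. field. unfold d. lra. }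
    specialize (Hh t ltac:(lra)).
    set (hU := (U t + g1 * t * U1 t + g2 * t ^ 2 * U2 t)%R) in *.
    set (hV := (V t + g1 * t * V1 t + g2 * t ^ 2 * V2 t)%R) in *.
    (* Multiplying by [2 d t] turns [E'] into the bound on [h] minus a sum of
       squares. *)
    apply Rmult_le_reg_l with t; auto. rewrite Rmult_0_r.
    assert (Hd : (0 < d)%R) by (unfold d; lra).
    apply Rmult_le_reg_l with (2 * d)%R; [lra|]. rewrite Rmult_0_r.
    replace (2 * d * (t * E' t))%R
      with (hU ^ 2 + hV ^ 2 - (k * t) ^ 2
            - ((hU - 2 * d * (t * U1 t)) ^ 2 + (hV - 2 * d * (t * V1 t)) ^ 2))%R.
    - pose proof (pow2_ge_0 (hU - 2 * d * (t * U1 t))).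
      pose proof (pow2_ge_0 (hV - 2 * d * (t * V1 t))). lra.
    - unfold E', hU, hV. field_simplify; [|lra].
      replace g1 with (d + g2)%R by (unfold d; ring). ring. }
  destruct (MVT_gen E 0 1 E') as [c [Hc HMVT]].
  - rewrite Rmin_left, Rmax_right by lra. intros t Ht. apply HE. lra.
  - rewrite Rmin_left, Rmax_right by lra. intros t Ht.
    apply continuity_pt_filterlim, (ex_derive_continuous (V := R_NormedModule)).
    exists (E' t). now apply HE.
  - rewrite Rmin_left, Rmax_right in Hc by lra.
    specialize (HE' c Hc). unfold E in HMVT. rewrite HU0, HV0 in HMVT.
    assert (0 <= g2 * (U1 1 ^ 2 + V1 1 ^ 2))%R
      by (apply Rmult_le_pos; [lra | nra]).
    replace (k ^ 2 / (4 * d))%R with (k ^ 2 * 1 ^ 2 / (4 * d))%R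
      by (field; unfold d; lra).
    lra.
Qed.

Lemma unit_disk_ray (z : C) (t : R) :
  unit_disk z -> (0 <= t <= 1)%R -> unit_disk (t * z).
Proof.
  unfold unit_disk. intros Hz Ht. rewrite Cmod_mult, Cmod_R, Rabs_pos_eq by lra.
  pose proof (Cmod_ge_0 z). nra.
Qed.

(** The factors [t] and [t ^ 2] of the Euler operator absorb the powers of [z]
    produced by differentiating along the ray of direction [z]. *)
Lemma euler_operator_bound (g1 g2 k : R) (p : C -> C) (z : C) :
  (0 < g2 < g1)%R -> analytic_on unit_disk p -> unit_disk z ->
  (forall y, unit_disk y ->
     (Cmod (p y + g1 * y * C_derive p y + g2 * y ^ 2 * C_derive (C_derive p) y
            - p 0)%C <= k * Cmod y)%R) ->
  (Cmod (p z - p 0) ^ 2 <= (k * Cmod z) ^ 2 / (4 * (g1 - g2)))%R.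
Proof.
  intros Hg Hp Hz Hk.
  rewrite Cmod2_alt.
  set (p1 := C_derive p) in *. set (p2 := C_derive p1) in *.
  pose proof (euler_operator_energy_bound g1 g2 (k * Cmod z)
    (fun t : R => Re (1 * p (t * z)%C) - Re (p 0%C))%R
    (fun t : R => Re (1 * (z * p1 (t * z)))) (fun t : R => Re (z * (z * p2 (t * z))))
    (fun t : R => Im (1 * p (t * z)%C) - Im (p 0%C))%R
    (fun t : R => Im (1 * (z * p1 (t * z)))) (fun t : R => Im (z * (z * p2 (t * z)))) Hg)
    as H.
  cbv beta in H. rewrite !Cmult_1_l in H.
  unfold Cminus. rewrite re_plus, im_plus, re_opp, im_opp. apply H; clear H.
  - intros t Ht.
    destruct (analytic_at_C_derive p (t * z)) as [D1 A1].
    { apply Hp, unit_disk_ray; auto. }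
    destruct (analytic_at_C_derive p1 (t * z) A1) as [D2 _].
    destruct (is_derive_ray p 1 z _ t D1) as [R1 I1].
    destruct (is_derive_ray p1 z z _ t D2) as [R2 I2].
    split; [|split; [|split]].
    + rewrite <- (minus_zero_r (G := R_AbelianGroup) (Re (1 * (z * p1 (t * z))))).
      exact (is_derive_minus _ (fun _ => Re (p 0)) t _ _ R1 (is_derive_const _ t)).
    + apply is_derive_ext with (2 := R2). intros s. now rewrite Cmult_1_l.
    + rewrite <- (minus_zero_r (G := R_AbelianGroup) (Im (1 * (z * p1 (t * z))))).
      exact (is_derive_minus _ (fun _ => Im (p 0)) t _ _ I1 (is_derive_const _ t)).
    + apply is_derive_ext with (2 := I2). intros s. now rewrite Cmult_1_l.
  - rewrite Cmult_0_l. ring.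
  - rewrite Cmult_0_l. ring.
  - intros t Ht. rewrite !Cmult_1_l.
    specialize (Hk (t * z) (unit_disk_ray z t Hz Ht)).
    set (y := p (t * z) + g1 * (t * z) * p1 (t * z)
              + g2 * (t * z) ^ 2 * p2 (t * z) - p 0) in Hk.
    rewrite (Cmod_mult t z), Cmod_R, (Rabs_pos_eq t) in Hk by lra.
    apply Rle_trans with (Cmod y ^ 2)%R.
    + rewrite Cmod2_alt. right.
      replace y with (p (t * z) - p 0 + (g1 * t)%R * (z * p1 (t * z))
                      + (g2 * t ^ 2)%R * (z * (z * p2 (t * z)))).
      * unfold Cminus. rewrite !re_plus, !im_plus, !re_scal_l, !im_scal_l, re_opp, im_opp.
        ring.
      * unfold y. rewrite !RtoC_mult, RtoC_pow. simpl. ring.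
    + replace (k * Cmod z * t)%R with (k * (t * Cmod z))%R by ring.
      apply pow_incr. split; [apply Cmod_ge_0 | exact Hk].
Qed.

(** * Subordination *)

Lemma exp_1_gt_2 : (2 < exp 1)%R.
Proof. pose proof (exp_ineq1 1 ltac:(lra)). lra. Qed.

(** The second alternative contradicts [exp 1 > 1]. In the first one, [exp 1 > 2]
    and [PI > 3] give [exp 1 * (exp 1 + 1) + PI * exp 1 / 2 > 6 + 3]. *)
Lemma parameter_gap (g1 g2 : R) :
  (0 < g1)%R -> (0 < g2)%R ->
  (2 * (g1 - g2 - exp 1 * (exp 1 + 1)) >= PI * exp 1)%R \/
  (2 * (1 - exp 1 * (1 + g1 + g2)) >= PI)%R ->
  (9 <= g1 - g2)%R.
Proof.
  intros H1 H2 H. pose proof exp_1_gt_2. pose proof PI2_3_2.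
  destruct H as [H|H]; nra.
Qed.

Lemma subordinate_Cexp (p : C -> C) :
  analytic_on unit_disk p ->
  (forall z, unit_disk z -> (Cmod (p z - 1)%C <= / 2 * Cmod z)%R) ->
  subordinate p Cexp.
Proof.
  intros Hp Hb.
  assert (Hre : forall z, unit_disk z -> (0 < Re (p z))%R).
  { intros z Hz. pose proof (re_le_Cmod (p z - 1)) as H.
    unfold Cminus in H. rewrite re_plus, re_opp, re_RtoC in H.
    specialize (Hb z Hz). unfold unit_disk, Cminus in *.
    apply Rabs_le_between in H. lra. }
  assert (Hlog : forall z, unit_disk z -> (Cmod (Clog (p z)) <= Cmod z)%R).
  { intros z Hz. specialize (Hb z Hz). unfold unit_disk in Hz.
    replace (p z) with (1 + (p z - 1)) by ring.
    apply Rle_trans with (1 := Clog_1_plus_bound (p z - 1) ltac:(lra)). lra. }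
  exists (fun z => Clog (p z)). split; [|split; [|split; [|split]]].
  - intros z Hz. apply analytic_at_Clog; auto.
  - intros z Hz. specialize (Hlog z Hz). unfold unit_disk in *. lra.
  - apply Cmod_eq_0. apply Rle_antisym; [|apply Cmod_ge_0].
    rewrite <- Cmod_0 at 2. apply Hlog. unfold unit_disk. rewrite Cmod_0. lra.
  - exact Hlog.
  - intros z Hz. symmetry. apply Cexp_Clog. intros H.
    specialize (Hre z Hz). rewrite H in Hre. simpl in Hre. lra.
Qed.

Theorem theorem3p4 (gamma1 gamma2 : R) (p : C -> C)
  (hgamma1 : (0 < gamma1)%R) (hgamma2 : (0 < gamma2)%R)
  (hgamma :
    (2 * (gamma1 - gamma2 - exp 1 * (exp 1 + 1)) >= PI * exp 1)%R \/
    (2 * (1 - exp 1 * (1 + gamma1 + gamma2)) >= PI)%R)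
  (hp : analytic_on unit_disk p)
  (hp0 : p 0 = 1)
  (hsub : subordinate
    (fun z : C => p z + gamma1 * z * C_derive p z
                  + gamma2 * z ^ 2 * C_derive (C_derive p) z)
    (fun z : C => 1 + Casinh z)) :
  subordinate p Cexp.
Proof.
  pose proof (parameter_gap _ _ hgamma1 hgamma2 hgamma) as Hgap.
  destruct hsub as (w & _ & Hw & _ & Hwz & Hpw).
  apply subordinate_Cexp; auto. intros z Hz.
  assert (H : (Cmod (p z - p 0) ^ 2
               <= (3 * Cmod z) ^ 2 / (4 * (gamma1 - gamma2)))%R).
  { apply euler_operator_bound; auto; [lra|]. intros y Hy.
    rewrite (Hpw y Hy), hp0.
    replace (1 + Casinh (w y) - 1) with (Casinh (w y)) by ring.
    apply Rle_trans with (1 := Casinh_bound (w y) (Hw y Hy)).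
    apply Rmult_le_compat_l; [lra | now apply Hwz]. }
  rewrite hp0 in H. pose proof (Cmod_ge_0 z). pose proof (Cmod_ge_0 (p z - 1)).
  assert (H' : ((3 * Cmod z) ^ 2 / (4 * (gamma1 - gamma2)) <= (/ 2 * Cmod z) ^ 2)%R).
  { apply Rmult_le_reg_r with (4 * (gamma1 - gamma2))%R; [lra|].
    unfold Rdiv. rewrite Rmult_assoc, Rinv_l by lra. nra. }
  apply Rsqr_incr_0; unfold Rsqr; lra.
Qed.
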